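(* Let $X$ be an infinite-dimensional complex Banach space and $T\in L(X)$, and suppose $T$ admits a GKRD $(M,N)$. Then there exists $\epsilon>0$ such that $T-\lambda$ is essentially Kato for every $\lambda$ with $0<|\lambda|<\epsilon$.
   Context: $S$ is Kato if $R(S)$ is closed and $N(S)\subset R(S^n)$ for all $n\in\mathbb N$; $S$ is Riesz if $S-\lambda$ is Fredholm for all $\lambda\neq0$; $T$ admits a GKRD $(M,N)$ if $M,N$ are closed $T$-invariant subspaces with $X=M\oplus N$, $T_M$ Kato and $T_N$ Riesz. An operator $S$ is essentially Kato if there are closed $S$-invariant subspaces $M,N$ with $X=M\oplus N$, $N$ finite-dimensional, $S_M$ Kato and $S_N$ nilpotent (equivalently quasinilpotent). *)

(* Defs.v *)
From HB Require Import structures.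
From mathcomp Require Import all_boot all_order all_algebra.
From mathcomp Require Import all_classical all_reals all_analysis.
From mathcomp Require Import complex.
Set Implicit Arguments. Unset Strict Implicit. Unset Printing Implicit Defensive.
Import Order.TTheory GRing.Theory Num.Theory.
Import numFieldNormedType.Exports.
Local Open Scope classical_set_scope.
Local Open Scope ring_scope.

(* Operator-theoretic notions on a normed module X over a numeric field K.
   Subspaces are represented as sets of X; operators as functions X -> X.
   "S restricted to the invariant subspace M" (S_M) is expressed through the
   images/kernels of S on M, i.e. S_M has range S @` M and kernel M `&` ker S. *)
Section OpDefs.
Variables (K : numFieldType) (X : normedModType K).

Definition is_subspace (M : set X) : Prop :=
  M 0 /\ forall (a : K) (x y : X), M x -> M y -> M (a *: x + y).

Definition closed_subspace (M : set X) : Prop := is_subspace M /\ closed M.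

Definition invariant (S : X -> X) (M : set X) : Prop :=
  forall x, M x -> M (S x).

Definition span (s : seq X) : set X :=
  [set x | exists c : 'I_(size s) -> K, x = \sum_(i < size s) c i *: s`_i].

Definition finite_dim (M : set X) : Prop := exists s : seq X, M = span s.

Definition direct_sum (M N : set X) : Prop :=
  (forall x, exists m n, M m /\ N n /\ x = m + n) /\
  (forall x, M x -> N x -> x = 0).

Definition ker_on (M : set X) (S : X -> X) : set X := M `&` (S @^-1` [set 0]).

Definition Kato_on (M : set X) (S : X -> X) : Prop :=
  closed (S @` M) /\ forall n : nat, ker_on M S `<=` (iter n S) @` M.

Definition Fredholm_on (N : set X) (S : X -> X) : Prop :=
  finite_dim (ker_on N S) /\ closed (S @` N) /\
  exists s : seq X, (forall i, (i < size s)%N -> N s`_i) /\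
    N `<=` [set x | exists y z, (S @` N) y /\ span s z /\ x = y + z].

Definition Riesz_on (N : set X) (S : X -> X) : Prop :=
  forall lam : K, lam != 0 -> Fredholm_on N (fun x => S x - lam *: x).

Definition nilpotent_on (N : set X) (S : X -> X) : Prop :=
  exists n : nat, forall x, N x -> iter n S x = 0.

Definition GKRD (T : X -> X) (M N : set X) : Prop :=
  closed_subspace M /\ closed_subspace N /\ invariant T M /\ invariant T N /\
  direct_sum M N /\ Kato_on M T /\ Riesz_on N T.

Definition essentially_Kato (S : X -> X) : Prop :=
  exists M N : set X,
    closed_subspace M /\ closed_subspace N /\ invariant S M /\ invariant S N /\
    direct_sum M N /\ finite_dim N /\ Kato_on M S /\ nilpotent_on N S.

End OpDefs.

(* Main.v *)
Require Import Defs.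
From HB Require Import structures.
From mathcomp Require Import all_boot all_order all_algebra.
From mathcomp Require Import all_classical all_reals all_analysis.
From mathcomp Require Import complex.
From mathcomp Require Import ring lra.
Set Implicit Arguments. Unset Strict Implicit. Unset Printing Implicit Defensive.
Import Order.TTheory GRing.Theory Num.Theory.
Import numFieldNormedType.Exports.
Local Open Scope classical_set_scope.
Local Open Scope ring_scope.
Local Open Scope complex_scope.

(* The shift by [lam] is treated separately on [M] and [N], and the results are
   glued along [X = M (+) N], whose projections are bounded by the open mapping
   theorem.

   On [M], let [c] bound preimages under [T] and let [Y] be the intersection of
   the ranges of [T^n] on [M].  Then [T Y = Y], so [T - lam] maps [Y] onto [Y]
   once [|lam| c <= 1/2], and [Y] contains the kernel of [T - lam]; this gives
   the kernel condition.  The range stays closed because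
   [dist (x, Y) <= c dist (T x, Y)], an inequality stable under small shifts.

   On [N], [T - lam] is Fredholm.  As long as it is not Kato, a kernel vector
   outside some range [R(S^(k+1))], but inside [R(S^k)], splits off a
   finite-dimensional nilpotent Jordan block, and the kernel of the complement
   is strictly smaller. *)

(* Norms over [R[i]] take values in [R[i]]; [nrm] is the same number in [R]. *)
Definition nrm {R : realType} {V : normedModType R[i]} (x : V) : R := complex.Re `|x|.

(** * Real-valued norms *)

Section RealNorm.
Context {R : realType} {V : normedModType R[i]}.
Implicit Types (x y : V) (a : R[i]) (F : set V).

Lemma nrmE x : `|x| = (nrm x)%:C.
Proof. by rewrite /nrm RRe_real ?normr_real. Qed.

Lemma nrm_ge0 x : 0 <= nrm x.
Proof. by rewrite -ler0c -nrmE. Qed.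

Lemma nrm_eq0 x : nrm x = 0 -> x = 0.
Proof. by move=> h; apply/normr0_eq0; rewrite nrmE h. Qed.

Lemma nrm_gt0 x : x <> 0 -> 0 < nrm x.
Proof.
move=> x0; rewrite lt_neqAle nrm_ge0 andbT.
by apply/eqP => /esym /nrm_eq0.
Qed.

Lemma nrm0 : nrm (0 : V) = 0.
Proof. by rewrite /nrm normr0. Qed.

Lemma nrmN x : nrm (- x) = nrm x.
Proof. by rewrite /nrm normrN. Qed.

Lemma nrmC x y : nrm (x - y) = nrm (y - x).
Proof. by rewrite -nrmN opprB. Qed.

Lemma nrmD x y : nrm (x + y) <= nrm x + nrm y.
Proof. by rewrite -lecR rmorphD /= -!nrmE ler_normD. Qed.

Lemma nrm_dist x y z : nrm (x - z) <= nrm (x - y) + nrm (y - z).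
Proof. by have := nrmD (x - y) (y - z); rewrite addrA subrK. Qed.

Lemma nrm_sub x y : nrm x <= nrm (x - y) + nrm y.
Proof. by have := nrmD (x - y) y; rewrite subrK. Qed.

Lemma nrmZ a x : nrm (a *: x) = nrm (a : R[i]^o) * nrm x.
Proof.
by apply: complexI; rewrite rmorphM /= -!nrmE normrZ.
Qed.

Lemma nrm_real (t : R) : 0 <= t -> nrm (t%:C : R[i]^o) = t.
Proof. by move=> t0; rewrite /nrm ger0_norm ?ler0c. Qed.

Lemma closed_nrmP F : closed F <->
  forall x, (forall e, 0 < e -> exists2 y, F y & nrm (x - y) < e) -> F x.
Proof.
split=> [Fc x hx|h].
  apply: Fc => B /nbhs_normP[e /= e0 eB].
  have eE : e = (complex.Re e)%:C by rewrite RRe_real ?gtr0_real.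
  have re0 : 0 < complex.Re e by rewrite -ltcR -eE.
  have [y Fy xy] := hx _ re0; exists y; split=> //.
  by apply: eB => /=; rewrite nrmE eE ltcR.
move=> x Fx; apply: h => e e0.
have : nbhs x (ball_ Num.Def.normr x (e%:C)).
  by apply/nbhs_normP; exists e%:C => //=; rewrite ltcR.
move=> /Fx[y [Fy /=]]; rewrite nrmE ltcR => xy.
by exists y.
Qed.

End RealNorm.

(** * Completeness and the open mapping theorem *)

Section FastCauchy.
Context {R : realType}.

(** The tail sum from [n] on is then at most [2 * r n], which gives explicit rates of
    convergence. *)
Definition halving (r : nat -> R) := (forall n, 0 <= r n) /\
  forall n, r n.+1 <= r n / 2.

Lemma halving_small (r : nat -> R) e : halving r -> 0 < e -> exists n, r n < e.
Proof.
move=> [r0 rh] e0.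
(* Decay like [1 / (n + 1)], from [n + 2 <= 2 * (n + 1)], is all that the Archimedean property
   needs. *)
have rn n : r n * n.+1%:R <= r 0%N.
  elim: n => [|n IH]; first by rewrite mulr1.
  apply: le_trans IH; apply: (@le_trans _ _ (r n / 2 * n.+2%:R)).
    by apply: ler_wpM2r.
  rewrite -mulrA; apply: ler_wpM2l => //.
  by rewrite ler_pdivrMl// -natrM ler_nat mul2n -addnn addnS ltnS leq_addr.
exists (Num.truncn (r 0%N / e)).
have := truncnS_gt (r 0%N / e).
rewrite ltr_pdivrMr// => h.
have := le_lt_trans (rn (Num.truncn (r 0%N / e))) h.
by rewrite [ltRHS]mulrC ltr_pM2r.
Qed.

Definition fast_cauchy {V : normedModType R[i]} (r : nat -> R) (x : nat -> V) :=
  halving r /\ forall n, nrm (x n.+1 - x n) <= r n.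

(** The negative term lets the induction telescope, since [r m <= 2 * r m - 2 * r m.+1]. *)
Lemma fast_cauchy_dist {V : normedModType R[i]} r (x : nat -> V) :
  fast_cauchy r x -> forall n k, nrm (x (n + k)%N - x n) <= 2 * r n - 2 * r (n + k)%N.
Proof.
move=> [[r0 rh] xr] n; elim=> [|k IH]; first by rewrite addn0 !subrr nrm0.
have := nrm_dist (x (n + k.+1)%N) (x (n + k)%N) (x n).
have := xr (n + k)%N; have := rh (n + k)%N; rewrite addnS.
lra.
Qed.

(* The bound [4] instead of the optimal [2] lets the product norm and the
   complex modulus be handled coordinatewise. *)
Definition complete_set {V : normedModType R[i]} (F : set V) :=
  forall r (x : nat -> V), fast_cauchy r x -> (forall n, F (x n)) ->
  exists2 l, F l & forall n, nrm (l - x n) <= 4 * r n.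

Lemma closed_complete (X : completeNormedModType R[i]) (F : set X) :
  closed F -> complete_set F.
Proof.
move=> Fc r x xr Fx; have [[r0 rh] _] := xr.
have dist := fast_cauchy_dist xr.
have : cvg (x @ \oo).
  apply: cauchy_cvg; apply: cauchy_exP => e e0.
  have eE : e = (complex.Re e)%:C by rewrite RRe_real ?gtr0_real.
  have re0 : 0 < complex.Re e / 2 by rewrite divr_gt0// -ltcR -eE.
  have [n rn] := halving_small xr.1 re0.
  exists (x n), n => // m /= nm; rewrite -ball_normE /= nrmE eE ltcR.
  have := dist n (m - n)%N; rewrite subnKC// nrmC.
  have := r0 m; lra.
rewrite cvg_ex => -[l /= xl].
have lim e : 0 < e -> forall n, exists k, nrm (l - x (n + k)%N) < e.
  move=> e0 n.
  have : \forall m \near \oo, nrm (l - x m) < e.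
    move/cvgrPdist_lt : xl => /(_ e%:C); rewrite ltcR => /(_ e0).
    by apply: filterS => m; rewrite nrmE ltcR.
  case=> m _ hm; exists m; apply: hm => /=; exact: leq_addl.
exists l => [|n].
  by move/closed_nrmP: Fc; apply=> e e0; have [k hk] := lim _ e0 0%N; exists (x (0 + k)%N).
apply/ler_addgt0Pr => e e0.
have [k hk] := lim _ e0 n.
have := nrm_dist l (x (n + k)%N) (x n); have := dist n k.
have := r0 n; have := r0 (n + k)%N; lra.
Qed.

End FastCauchy.

Section HalvingLimits.
Context {R : realType}.

Lemma halving_geom (c : R) : 0 <= c -> halving (fun n => c / 2 ^+ n).
Proof.
move=> c0; split=> n; first by rewrite divr_ge0// exprn_ge0.
by rewrite exprSr invfM mulrA.
Qed.

Lemma halving_squeeze (r : nat -> R) (a k : R) : halving r -> 0 <= k ->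
  (forall n, a <= k * r n) -> a <= 0.
Proof.
move=> rh k0 ar; rewrite leNgt; apply/negP => a0.
have k1 : 0 < k + 1 by lra.
have [n rn] := halving_small rh (divr_gt0 a0 k1).
have := ar n; move: rn; rewrite ltr_pdivlMr// => h1.
have := rh.1 n; lra.
Qed.

Lemma nrm_eq_lim (V : normedModType R[i]) (r : nat -> R) (k : R) (x y : V) :
  halving r -> 0 <= k -> (forall n, nrm (x - y) <= k * r n) -> x = y.
Proof.
move=> rh k0 h; apply/eqP; rewrite -subr_eq0; apply/eqP/nrm_eq0/le_anti.
by rewrite nrm_ge0 (halving_squeeze rh k0 h).
Qed.

(** The intervals of centre [a n] and radius [2 * r n] are nested; the supremum of their left ends
    lies in all of them. *)
Lemma real_fast_cauchy (r a : nat -> R) : halving r ->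
  (forall n, `|a n.+1 - a n| <= r n) -> exists l, forall n, `|l - a n| <= 2 * r n.
Proof.
move=> [r0 rh] ar.
have up n k : a (n + k)%N + 2 * r (n + k)%N <= a n + 2 * r n.
  elim: k => [|k IH]; first by rewrite addn0.
  apply: le_trans IH; rewrite addnS; have := ar (n + k)%N; have := rh (n + k)%N.
  rewrite ler_norml; lra.
have lo n k : a n - 2 * r n <= a (n + k)%N - 2 * r (n + k)%N.
  elim: k => [|k IH]; first by rewrite addn0.
  apply: (le_trans IH); rewrite addnS; have := ar (n + k)%N; have := rh (n + k)%N.
  rewrite ler_norml; lra.
have lu n m : a n - 2 * r n <= a m + 2 * r m.
  have := lo n m; have := up m n; rewrite [in X in X -> _]addnC.
  have := r0 (n + m)%N; lra.
set E := range (fun n => a n - 2 * r n).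
have Eub m : ubound E (a m + 2 * r m) by move=> _ [n _ <-].
have Es : has_sup E.
  by split; [exists (a 0%N - 2 * r 0%N), 0%N|exists (a 0%N + 2 * r 0%N)].
exists (sup E) => n; rewrite ler_norml; apply/andP; split.
  have : a n - 2 * r n <= sup E by apply: ub_le_sup; [exact: Es.2|exists n].
  lra.
have : sup E <= a n + 2 * r n by apply: ge_sup; [exact: Es.1|].
lra.
Qed.

Lemma nrm_scalar (z : R[i]) :
  nrm (z : R[i]^o) = Num.sqrt (complex.Re z ^+ 2 + complex.Im z ^+ 2).
Proof.
have -> : nrm (z : R[i]^o) = complex.Re (`|z| : R[i]) by [].
by rewrite normc_def.
Qed.

Lemma nrm_Re (z : R[i]) : `|complex.Re z| <= nrm (z : R[i]^o).
Proof.
rewrite nrm_scalar.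
by rewrite -sqrtr_sqr ler_wsqrtr// lerDl sqr_ge0.
Qed.

Lemma nrm_Im (z : R[i]) : `|complex.Im z| <= nrm (z : R[i]^o).
Proof.
rewrite nrm_scalar.
by rewrite -sqrtr_sqr ler_wsqrtr// lerDr sqr_ge0.
Qed.

Lemma nrm_ReIm (z : R[i]) : nrm (z : R[i]^o) <= `|complex.Re z| + `|complex.Im z|.
Proof.
rewrite nrm_scalar.
rewrite -(@ler_pXn2r _ 2)// ?nnegrE ?sqrtr_ge0 ?addr_ge0//.
rewrite sqr_sqrtr ?addr_ge0 ?sqr_ge0// sqrrD !real_normK ?num_real//.
by rewrite lerD2r lerDl mulrn_wge0 ?mulr_ge0.
Qed.

(** Real and imaginary parts converge separately, each within [2 * r n], and the modulus is at most
    their sum. *)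
Lemma complete_scalars : complete_set [set: R[i]^o].
Proof.
move=> r z [rh zr] _.
have [n|a ha] := @real_fast_cauchy r (fun n => complex.Re (z n)) rh.
  apply: le_trans (zr n); apply: le_trans (nrm_Re _).
  by case: (z n) (z n.+1) => [? ?] [? ?].
have [n|b hb] := @real_fast_cauchy r (fun n => complex.Im (z n)) rh.
  apply: le_trans (zr n); apply: le_trans (nrm_Im _).
  by case: (z n) (z n.+1) => [? ?] [? ?].
exists (a +i* b) => // n; apply: le_trans (nrm_ReIm _) _.
have := ha n; have := hb n; case: (z n) => [u v] /=; lra.
Qed.

Lemma nrm_prod_le (V W : normedModType R[i]) (p : V * W) (t : R) :
  (nrm p <= t) = (nrm p.1 <= t) && (nrm p.2 <= t).
Proof.
have -> : nrm p = Num.max (nrm p.1) (nrm p.2).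
  by apply: complexI; rewrite -nrmE prod_normE !nrmE /Order.max ltcR; case: ifP.
by rewrite ge_max.
Qed.

Lemma complete_setX (V W : normedModType R[i]) (F : set V) (G : set W) :
  complete_set F -> complete_set G -> complete_set (F `*` G).
Proof.
move=> Fc Gc r x [rh xr] FGx.
have [|n|a Fa ha] := Fc r (fun n => (x n).1).
- by split=> // n; have := xr n; rewrite nrm_prod_le => /andP[].
- by have [] := FGx n.
have [|n|b Gb hb] := Gc r (fun n => (x n).2).
- by split=> // n; have := xr n; rewrite nrm_prod_le => /andP[].
- by have [] := FGx n.
by exists (a, b) => // n; rewrite nrm_prod_le /= ha hb.
Qed.

End HalvingLimits.

Section Subspaces.
Context {R : realType} {V : normedModType R[i]}.
Implicit Types (F G : set V) (x y : V) (a : R[i]).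

Lemma subspaceD F x y : is_subspace F -> F x -> F y -> F (x + y).
Proof. by move=> [_ Fl] Fx Fy; have := Fl 1 x y Fx Fy; rewrite scale1r. Qed.

Lemma subspaceZ F a x : is_subspace F -> F x -> F (a *: x).
Proof. by move=> [F0 Fl] Fx; have := Fl a x 0 Fx F0; rewrite addr0. Qed.

Lemma subspaceN F x : is_subspace F -> F x -> F (- x).
Proof. by move=> Fs Fx; rewrite -scaleN1r; exact: subspaceZ. Qed.

Lemma subspaceB F x y : is_subspace F -> F x -> F y -> F (x - y).
Proof. by move=> Fs Fx Fy; apply: subspaceD => //; exact: subspaceN. Qed.

Lemma subspaceI F G : is_subspace F -> is_subspace G -> is_subspace (F `&` G).
Proof.
move=> [F0 Fl] [G0 Gl]; split=> // a x y [Fx Gx] [Fy Gy].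
by split; [exact: Fl|exact: Gl].
Qed.

Lemma subspace_image (W : normedModType R[i]) (S : {linear V -> W}) F :
  is_subspace F -> is_subspace (S @` F).
Proof.
move=> [F0 Fl]; split; first by exists 0; rewrite ?linear0.
move=> a _ _ [x Fx <-] [y Fy <-]; exists (a *: x + y); first exact: Fl.
by rewrite linearP.
Qed.

End Subspaces.

(** * Solving linear equations with norm bounds *)

Section BoundedPreimages.
Context {R : realType} {V W : normedModType R[i]}.
Implicit Types (S : {linear V -> W}) (F : set V) (B : set W).

Definition bounded_op S := exists2 k, 0 < k & forall x, nrm (S x) <= k * nrm x.

Lemma continuous_bounded_op S : continuous S -> bounded_op S.
Proof.
move=> /linear_bounded_continuous/linear_boundedP/pinfty_ex_gt0[M M0 SM].
have ME : M = (complex.Re M)%:C by rewrite RRe_real ?gtr0_real.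
exists (complex.Re M); first by rewrite -ltcR -ME.
by move=> x; rewrite -lecR rmorphM /= -ME -!nrmE.
Qed.

(** Quantitative openness onto the range: the map induced by [S] on [F] modulo its kernel has a
    bounded inverse. *)
Definition bounded_preimages S F (c : R) := forall x, F x ->
  exists y, [/\ F y, S y = S x & nrm y <= c * nrm (S x)].

(** Solving approximately and then correcting the residual gives a geometric series of corrections.
    The set [B] stands for whatever property the residuals keep: below it is the closure of the
    range, the range itself, or the hyperrange. *)
Lemma approx_solve S F B (c : R) : bounded_op S -> is_subspace F ->
  complete_set F -> 0 <= c ->
  (forall w, B w -> exists x,
    [/\ F x, nrm x <= c * nrm w, nrm (w - S x) <= nrm w / 2 & B (w - S x)]) ->
  forall w, B w -> exists x, [/\ F x, S x = w & nrm x <= 4 * c * nrm w].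
Proof.
move=> [k k0 Sk] Fs Fc c0 step w0 Bw0.
(* The approximate solutions are chosen for all [w] at once; outside [B] the value [0] is a
   dummy. *)
have /choice[f fP] w : exists x, B w ->
    [/\ F x, nrm x <= c * nrm w, nrm (w - S x) <= nrm w / 2 & B (w - S x)].
  have [/step[x hx]|nB] := pselect (B w); first by exists x.
  by exists 0.
pose w n := iter n (fun w => w - S (f w)) w0.
have Bw n : B (w n).
  by elim: n => // n IH; have [_ _ _] := fP _ IH.
pose x n := \sum_(i < n) f (w i).
have Sx n : S (x n) = w0 - w n.
  elim: n => [|n IH]; first by rewrite /x big_ord0 linear0 subrr.
  rewrite /x big_ord_recr linearD /= -/(x n) IH /w /= opprB addrA.
  by rewrite addrAC.
have Fx n : F (x n).
  elim: n => [|n IH]; first by rewrite /x big_ord0; exact: Fs.1.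
  rewrite /x big_ord_recr; apply: subspaceD => //.
  by have [] := fP _ (Bw n).
have wn n : nrm (w n) <= nrm w0 / 2 ^+ n.
  elim: n => [|n IH]; first by rewrite divr1.
  have [_ _ h _] := fP _ (Bw n); apply: (le_trans h).
  by rewrite exprSr invfM mulrA ler_pM2r.
have rh := halving_geom (mulr_ge0 c0 (nrm_ge0 w0)).
have xr : fast_cauchy (fun n => c * nrm w0 / 2 ^+ n) x.
  split=> // n; rewrite /x big_ord_recr /= addrAC subrr add0r.
  have [_ h _ _] := fP _ (Bw n); apply: (le_trans h).
  by rewrite -mulrA ler_wpM2l.
have [l Fl hl] := Fc _ _ xr Fx.
exists l; split=> //.
  (* The constant adds [4 * k * c] for the image of the error [l - x n] and [1] for the residual
     [w n]. *)
  apply: (nrm_eq_lim (halving_geom (nrm_ge0 w0)) (k := 4 * k * c + 1)).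
    by rewrite addr_ge0 ?mulr_ge0// ltW.
  move=> n; have -> : S l - w0 = S (l - x n) - w n.
    by rewrite linearB /= Sx opprB addrA addrAC addrK.
  apply: (le_trans (nrmD _ _)); rewrite nrmN mulrDl mul1r lerD//.
  apply: (le_trans (Sk _)).
  have -> : 4 * k * c * (nrm w0 / 2 ^+ n) = k * (4 * (c * nrm w0 / 2 ^+ n)) by ring.
  by rewrite ler_pM2l.
by have := hl 0%N; rewrite /x big_ord0 subr0 divr1 mulrA.
Qed.

(** Every point [w] of the closure of the range is solved exactly by successive approximation, as
    residuals stay in that closure. *)
Lemma closed_image S F (c : R) : bounded_op S -> is_subspace F ->
  complete_set F -> 0 <= c -> bounded_preimages S F c -> closed (S @` F).
Proof.
move=> Sb Fs Fc c0 bp; apply/closed_nrmP => w hw.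
pose B := [set w | forall e, 0 < e -> exists2 y, (S @` F) y & nrm (w - y) < e].
have c20 : 0 <= 2 * c by rewrite mulr_ge0.
have [|x [Fx Sx _]] := approx_solve (B := B) Sb Fs Fc c20 _ hw; last by exists x.
move=> {hw}w Bw; have [->|/eqP w0] := eqVneq w 0.
  exists 0; split; first exact: Fs.1.
  - by rewrite !nrm0 mulr0.
  - by rewrite linear0 subr0 nrm0 mul0r.
  - rewrite linear0 subr0 => e e0; exists 0; last by rewrite subr0 nrm0.
    by exists 0; rewrite ?linear0//; exact: Fs.1.
have w1 := nrm_gt0 w0.
(* The norm of [S z] is at most [3 / 2 * nrm w], so [2 * c] bounds the preimage. *)
have [|_ [z Fz <-] wz] := Bw (nrm w / 2); first by rewrite divr_gt0.
have [y [Fy Sy yc]] := bp _ Fz.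
exists y; rewrite Sy; split=> //; last 1 first.
- move=> e e0; have [_ [u Fu <-] wu] := Bw _ e0.
  exists (S (u - z)); first by exists (u - z) => //; exact: subspaceB.
  by rewrite linearB /= opprB addrA subrK.
- apply: (le_trans yc); rewrite [2 * c]mulrC -mulrA ler_wpM2l//.
  have := nrm_sub (S z) w; rewrite nrmC; lra.
- exact: ltW.
Qed.

(* Baire's argument: if no [S] (ball of radius n) were dense in a ball of the
   range, nested balls avoiding all of them would shrink to a point of the range. *)
Lemma open_mapping S F : bounded_op S -> is_subspace F ->
  complete_set F -> complete_set (S @` F) ->
  exists2 c, 0 < c & bounded_preimages S F c.
Proof.
move=> Sb Fs Fc SFc.
have SFs : is_subspace (S @` F) by exact: subspace_image.
have [n [w0 [r [r0 [x0 Fx0 w0E] dense]]]] : exists n w0 (r : R),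
    [/\ 0 < r, (S @` F) w0 & forall w, (S @` F) w -> nrm (w - w0) < r ->
      forall e, 0 < e -> exists x, [/\ F x, nrm x <= n%:R & nrm (w - S x) < e]].
  apply: contrapT => no.
  (* The new centre stays away from the images by more than [4] times the new radius, which is as
     far as [complete_set] lets the limit be from a centre. *)
  have step (n : nat) (p : W * R) : exists q : W * R,
      (S @` F) p.1 -> 0 < p.2 ->
      [/\ (S @` F) q.1, nrm (q.1 - p.1) <= p.2, 0 < q.2, q.2 <= p.2 / 2 &
       forall x, F x -> nrm x <= n%:R -> 4 * q.2 < nrm (q.1 - S x)].
    have [[Fp p0]|np] := pselect ((S @` F) p.1 /\ 0 < p.2); last first.
      by exists p => Fp p0; case: np.
    apply: contrapT => noq; apply: no; exists n, p.1, p.2; split=> // w Fw wp e e0.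
    apply: contrapT => nox; apply: noq.
    (* The radius [e / 8] keeps [4 * q.2] below [e]. *)
    exists (w, Num.min (p.2 / 2) (e / 8)) => _ _; split=> //=.
    - exact: ltW.
    - by rewrite lt_min !divr_gt0.
    - by rewrite ge_min lexx.
    - move=> x Fx xn; rewrite ltNge; apply/negP => h; apply: nox; exists x.
      split=> //; apply: (le_lt_trans h).
      have : Num.min (p.2 / 2) (e / 8) <= e / 8 by rewrite ge_min lexx orbT.
      lra.
  have /choice[f fP] (np : nat * (W * R)) := step np.1 np.2.
  pose fix p n : W * R := if n is m.+1 then f (m, p m) else (0, 1).
  have pP n : (S @` F) (p n).1 /\ 0 < (p n).2.
    elim: n => [|n [Fp p0]]; first by split=> //=; exact: SFs.1.
    by have [] := fP (n, p n) Fp p0.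
  have pS n := fP (n, p n) (pP n).1 (pP n).2.
  have [|n|_ [x Fx <-] hl] := SFc (fun n => (p n).2) (fun n => (p n).1).
  - split; last by move=> n; have [] := pS n.
    by split=> n; [exact/ltW/(pP n).2|have [] := pS n].
  - exact: (pP n).1.
  (* The limit is [S x], but the ball built at a stage [n] beyond the norm of [x] excludes it. *)
  pose n := (Num.truncn (nrm x)).+1.
  have [_ _ _ _ /(_ x Fx)] := pS n.
  have /ltW xn : nrm x < n%:R by exact: truncnS_gt.
  by move=> /(_ xn); rewrite nrmC ltNge => /negP; apply; exact: (hl n.+1).
(* A preimage of norm at most [2 * n] is divided below by [t = r / (2 * nrm w)]; the summand [1]
   keeps [c] positive when [n = 0]. *)
pose c := 4 * n%:R / r + 1.
have c0 : 0 < c.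
  by rewrite /c addrC ltr_pwDl// divr_ge0 ?mulr_ge0// ltW.
exists (4 * c); first by rewrite mulr_gt0.
move=> z Fz.
have [|x [Fx Sx xc]] := approx_solve (B := S @` F) Sb Fs Fc (ltW c0) _
    (ex_intro2 _ _ z Fz erefl); last by exists x.
move=> w [u Fu uw]; have [w00|/eqP w1] := eqVneq w 0.
  exists 0; split; first exact: Fs.1.
  - by rewrite w00 !nrm0 mulr0.
  - by rewrite linear0 subr0 w00 nrm0 mul0r.
  - by rewrite linear0 subr0; exists u.
have {}w1 := nrm_gt0 w1.
(* Scaling by [t] gives [w] the norm [r / 2], so that adding it to [w0] stays in the ball. *)
pose t := r / (2 * nrm w).
have t0 : 0 < t by rewrite divr_gt0// mulr_gt0.
pose e := t * nrm w / 4.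
have e0 : 0 < e by rewrite divr_gt0// mulr_gt0.
have [||x1 [Fx1 x1n x1e]] := dense (w0 + t%:C *: w) _ _ e e0.
- apply: subspaceD => //; first by exists x0.
  by apply: subspaceZ => //; exists u.
- rewrite addrAC subrr add0r nrmZ nrm_real ?ltW// /t.
  rewrite invfM mulrA -mulrA mulVf ?gt_eqF// mulr1; lra.
have [||x2 [Fx2 x2n x2e]] := dense w0 _ _ e e0.
- by exists x0.
- by rewrite subrr nrm0.
have ti0 : 0 <= t^-1 by rewrite invr_ge0 ltW.
exists ((t^-1)%:C *: (x1 - x2)).
(* The difference cancels the centre [w0]; the error [2 * e] is half the norm of the scaled [w]. *)
have key : nrm (t%:C *: w - S (x1 - x2)) <= 2 * e.
  have -> : t%:C *: w - S (x1 - x2) = (w0 + t%:C *: w - S x1) - (w0 - S x2).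
    rewrite linearB /= !opprB [w0 + _]addrC [_ + w0 - _]addrAC -[RHS]addrA.
    by rewrite [w0 + _]addrCA subrr addr0 addrAC addrA.
  apply: (le_trans (nrmD _ _)); rewrite nrmN; lra.
have SFx : F ((t^-1)%:C *: (x1 - x2)).
  by apply: subspaceZ => //; exact: subspaceB.
split=> //.
- rewrite nrmZ nrm_real//.
  have h : nrm (x1 - x2) <= 2 * n%:R.
    have := nrmD x1 (- x2); rewrite nrmN; lra.
  rewrite ler_pdivrMl//; apply: (le_trans h).
  have -> : t * (c * nrm w) = r / 2 * c.
    by rewrite /t; field; rewrite gt_eqF.
  have -> : r / 2 * c = 2 * n%:R + r / 2.
    by rewrite /c; field; rewrite gt_eqF.
  by rewrite lerDl divr_ge0// ltW.
- have -> : w - S ((t^-1)%:C *: (x1 - x2)) =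
      (t^-1)%:C *: (t%:C *: w - S (x1 - x2)).
    by rewrite linearZ scalerBr scalerA -rmorphM /= mulVf ?gt_eqF// scale1r.
  rewrite nrmZ nrm_real// ler_pdivrMl//.
  by apply: (le_trans key); rewrite /e; lra.
- apply: subspaceB => //; first by exists u.
  by exists ((t^-1)%:C *: (x1 - x2)).
Qed.

End BoundedPreimages.

(** * Spans and sums of subspaces *)

Section Spans.
Context {R : realType} {X : normedModType R[i]}.
Local Notation lspan := (@Defs.span R[i] X).
Implicit Types (F G : set X) (x y v : X) (s t : seq X).

Definition add_line F v : set X := [set x | exists a y, F y /\ x = a *: v + y].

Lemma span_nil : lspan [::] = [set 0 : X].
Proof.
apply/seteqP; split=> x; first by case=> c ->; rewrite big_ord0.
by move=> ->; exists (fun=> 0); rewrite big_ord0.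
Qed.

Lemma span_cons v s : lspan (v :: s) = add_line (lspan s) v.
Proof.
apply/seteqP; split=> x.
  case=> c ->; exists (c ord0), (\sum_(i < size s) c (lift ord0 i) *: s`_i).
  by split; [exists (fun i => c (lift ord0 i))|rewrite big_ord_recl].
case=> a [_ [[c ->] ->]].
exists (fun i => if unlift ord0 i is Some j then c j else a).
rewrite big_ord_recl /= unlift_none; congr (_ + _).
by apply: eq_bigr => i _; rewrite liftK.
Qed.

Lemma subspace_add_line F v : is_subspace F -> is_subspace (add_line F v).
Proof.
move=> [F0 Fl]; split; first by exists 0, 0; rewrite scale0r addr0.
move=> a _ _ [b [y [Fy ->]]] [c [z [Fz ->]]].
exists (a * b + c), (a *: y + z); split; first exact: Fl.
by rewrite scalerDr scalerDl scalerA addrACA.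
Qed.

Lemma sub_add_line F v : F `<=` add_line F v.
Proof. by move=> x Fx; exists 0, x; rewrite scale0r add0r. Qed.

Lemma mem_add_line F v : is_subspace F -> add_line F v v.
Proof. by move=> [F0 _]; exists 1, 0; rewrite scale1r addr0. Qed.

Lemma add_line_id F v : is_subspace F -> F v -> add_line F v = F.
Proof.
move=> Fs Fv; apply/seteqP; split; last exact: sub_add_line.
move=> _ [a [y [Fy ->]]]; apply: subspaceD => //; exact: subspaceZ.
Qed.

Lemma subspace0 : is_subspace [set 0 : X].
Proof. by split=> // a x y -> ->; rewrite scaler0 addr0. Qed.

Lemma subspace_span s : is_subspace (lspan s).
Proof.
elim: s => [|v s IH]; first by rewrite span_nil; exact: subspace0.
by rewrite span_cons; exact: subspace_add_line.
Qed.

Lemma span_sub F s : is_subspace F -> (forall v, v \in s -> F v) -> lspan s `<=` F.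
Proof.
move=> Fs; elim: s => [|v s IH] hs; first by rewrite span_nil => _ ->; exact: Fs.1.
rewrite span_cons => _ [a [y [sy ->]]]; apply: subspaceD => //.
  by apply: subspaceZ => //; apply: hs; rewrite mem_head.
by apply: IH => // w ws; apply: hs; rewrite in_cons ws orbT.
Qed.

Lemma mem_span s v : v \in s -> lspan s v.
Proof.
elim: s => // w s IH; rewrite in_cons span_cons => /orP[/eqP ->|/IH].
  by apply: mem_add_line; exact: subspace_span.
exact: sub_add_line.
Qed.

Definition sumset F G : set X := [set x | exists y z, [/\ F y, G z & x = y + z]].

Lemma subspace_sumset F G : is_subspace F -> is_subspace G ->
  is_subspace (sumset F G).
Proof.
move=> [F0 Fl] [G0 Gl]; split; first by exists 0, 0; rewrite addr0.
move=> a _ _ [y [z [Fy Gz ->]]] [y' [z' [Fy' Gz' ->]]].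
exists (a *: y + y'), (a *: z + z'); split; [exact: Fl|exact: Gl|].
by rewrite scalerDr addrACA.
Qed.

(** Moving one vector at a time to the first summand reduces finite-dimensional extensions to adding
    a single line. *)
Lemma sumset_span_cons F v s :
  sumset F (lspan (v :: s)) = sumset (add_line F v) (lspan s).
Proof.
rewrite span_cons; apply/seteqP; split=> x.
  move=> [y [_ [Fy [a [z [sz ->]]] ->]]]; exists (a *: v + y), z.
  by split=> //; [exists a, y|rewrite addrCA addrA].
move=> [_ [z [[a [y [Fy ->]]] sz ->]]]; exists y, (a *: v + z).
by split=> //; [exists a, z|rewrite addrCA addrA].
Qed.

Lemma sumset_span_nil F : sumset F (lspan [::]) = F.
Proof.
rewrite span_nil; apply/seteqP; split=> x.
  by move=> [y [_ [Fy -> ->]]]; rewrite addr0.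
by move=> Fx; exists x, 0; rewrite addr0.
Qed.

Lemma span_cat s t : lspan (s ++ t) = sumset (lspan t) (lspan s).
Proof.
elim: s => [|v s IH]; first by rewrite sumset_span_nil.
rewrite cat_cons span_cons IH span_cons; apply/seteqP; split=> x.
  move=> [a [_ [[y [z [ty sz ->]]] ->]]]; exists y, (a *: v + z).
  by split=> //; [exists a, z|rewrite addrCA].
move=> [y [_ [ty [a [z [sz ->]]] ->]]]; exists a, (y + z).
by split; [exists y, z|rewrite addrCA].
Qed.

Lemma image_span (S : {linear X -> X}) s :
  S @` lspan s = lspan (map S s).
Proof.
elim: s => [|v s IH].
  by rewrite span_nil image_set1 linear0 -span_nil.
rewrite span_cons /= span_cons -IH; apply/seteqP; split=> x.
  move=> [_ [a [y [sy ->]]] <-]; exists a, (S y); rewrite linearP.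
  by split=> //; exists y.
move=> [a [_ [[y sy <-] ->]]]; exists (a *: v + y); first by exists a, y.
by rewrite linearP.
Qed.

Lemma subspace_span_size s F : is_subspace F -> F `<=` lspan s ->
  exists t, [/\ F = lspan t, (size t <= size s)%N &
    F <> lspan s -> (size t < size s)%N].
Proof.
elim: s F => [|v s IH] F Fs Fsp.
  exists [::]; have FE : F = lspan [::].
    by apply/seteqP; split=> // x; rewrite span_nil => ->; exact: Fs.1.
  by split.
have ss := subspace_span s; have [Gs Gsp] : is_subspace (F `&` lspan s) /\ F `&` lspan s `<=` lspan s.
  by split; [exact: subspaceI|move=> x []].
have [t [tE ts tlt]] := IH _ Gs Gsp.
have [Fin|] := pselect (F `<=` lspan s).
  exists t; split=> /=; [|exact: leqW|by rewrite ltnS].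
  by rewrite -tE; apply/seteqP; split=> x; [move=> Fx; split=> //; exact: Fin|case].
move/existsNP => [u /not_implyP[Fu nu]].
have := Fsp u Fu; rewrite span_cons => -[a [w [sw uE]]].
have a0 : a != 0 by apply/eqP => a0; apply: nu; rewrite uE a0 scale0r add0r.
exists (u :: t); split; rewrite ?ltnS//=.
  rewrite span_cons -tE; apply/seteqP; split=> x.
    move=> Fx; have := Fsp x Fx; rewrite span_cons => -[b [z [sz xE]]].
    exists (b / a), (x - (b / a) *: u); split; last by rewrite addrC subrK.
    split; first by apply: subspaceB => //; exact: subspaceZ.
    rewrite uE xE scalerDr scalerA divfK// opprD addrACA subrr add0r.
    by apply: subspaceB => //; exact: subspaceZ.
  by move=> [b [y [[Fy _] ->]]]; apply: subspaceD => //; exact: subspaceZ.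
(* If [F] contained the whole span of the tail, [v] could be recovered from [u], and [F] would be
   everything. *)
move=> Fn; apply: tlt => FE; apply: Fn; apply/seteqP; split=> x.
  by move=> /Fsp; rewrite span_cons.
have sF y : lspan s y -> F y by rewrite -FE => -[].
move=> [b [z [sz ->]]]; apply: subspaceD; [exact: Fs| |exact: sF].
apply: subspaceZ => //.
have -> : v = a^-1 *: (u - w) by rewrite uE addrK scalerA mulVf// scale1r.
by apply: subspaceZ => //; apply: subspaceB => //; exact: sF.
Qed.

End Spans.

(** * Closed sums and closed images *)

Section ClosedSums.
Context {R : realType} {X : completeNormedModType R[i]}.
Implicit Types (F G M N : set X) (v : X) (s : seq X).
Local Notation lspan := (@Defs.span R[i] X).

(** Sums of subspaces become images of products, to which the open mapping and closed range results
    apply. *)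
Definition add_pair (p : X * X) : X := p.1 + p.2.

Lemma add_pair_is_linear : linear add_pair.
Proof. by move=> a [x y] [x' y']; rewrite /add_pair /= scalerDr addrACA. Qed.

HB.instance Definition _ :=
  GRing.isLinear.Build R[i] (X * X)%type X _ add_pair add_pair_is_linear.

Lemma bounded_add_pair : bounded_op add_pair.
Proof.
exists 2 => // p; have : nrm p <= nrm p by [].
rewrite nrm_prod_le => /andP[h1 h2]; have := nrmD p.1 p.2; rewrite /add_pair; lra.
Qed.

Lemma subspaceX F G : is_subspace F -> is_subspace G ->
  is_subspace (F `*` G : set (X * X)%type).
Proof.
move=> [F0 Fl] [G0 Gl]; split=> // a [x y] [x' y'] [/= Fx Gy] [/= Fx' Gy'].
by split; [exact: Fl|exact: Gl].
Qed.

Lemma add_pair_image F G : add_pair @` (F `*` G) = sumset F G.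
Proof.
apply/seteqP; split=> x.
  by move=> [[y z] [/= Fy Gz] <-]; exists y, z.
by move=> [y [z [Fy Gz ->]]]; exists (y, z).
Qed.

(** Addition maps the product of [M] and [N] onto [X], so it has bounded preimages. Directness makes
    the preimage of [x + y] the pair [(x, y)] itself, hence the bound passes to [F] and [G]. *)
Lemma closed_sub_direct_sum M N F G : closed_subspace M -> closed_subspace N ->
  direct_sum M N -> closed_subspace F -> closed_subspace G ->
  F `<=` M -> G `<=` N -> closed_subspace (sumset F G).
Proof.
move=> [Ms Mc] [Ns Nc] [MN dis] [Fs Fc] [Gs Gc] FM GN.
split; first exact: subspace_sumset.
have [||c c0 bp] := open_mapping bounded_add_pair (subspaceX Ms Ns).
- by apply: complete_setX; exact: closed_complete.
- apply: closed_complete; rewrite add_pair_image (_ : sumset M N = setT).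
    exact: closedT.
  apply/seteqP; split=> // x _; have [y [z [My [Nz ->]]]] := MN x.
  by exists y, z.
rewrite -add_pair_image.
apply: (closed_image bounded_add_pair (subspaceX Fs Gs) _ (ltW c0)).
  by apply: complete_setX; exact: closed_complete.
move=> [x y] [/= Fx Gy].
have [|[x' y'] [[/= Mx' Ny'] sE le]] := bp (x, y); first by split; [exact: FM|exact: GN].
exists (x, y); split=> //.
move: sE le; rewrite /add_pair /= => sE.
have xE : x' = x.
  apply/eqP; rewrite -subr_eq0; apply/eqP/dis.
    by apply: subspaceB => //; exact: FM.
  rewrite (_ : x' - x = y - y'); last first.
    by apply/eqP; rewrite subr_eq addrAC eq_sym subr_eq sE addrC.
  by apply: subspaceB => //; exact: GN.
by move: sE; rewrite xE => /addrI ->.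
Qed.

Definition line_map v (p : X * R[i]^o) : X := p.1 + (p.2 : R[i]) *: v.

Lemma line_map_is_linear v : linear (line_map v).
Proof.
move=> a [x b] [x' b']; rewrite /line_map /= scalerDr scalerDl.
by rewrite -[a *: b]/(a * b) -scalerA addrACA.
Qed.

HB.instance Definition _ v :=
  GRing.isLinear.Build R[i] (X * R[i]^o)%type X _ (line_map v)
    (line_map_is_linear v).

Lemma bounded_line_map v : bounded_op (line_map v).
Proof.
exists (1 + nrm v); first by rewrite ltr_pwDl ?nrm_ge0.
move=> p; have : nrm p <= nrm p by [].
rewrite nrm_prod_le => /andP[h1 h2].
have := nrmD p.1 ((p.2 : R[i]) *: v); rewrite nrmZ => h; apply: (le_trans h).
by rewrite mulrDl mul1r lerD// mulrC ler_wpM2l ?nrm_ge0.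
Qed.

Lemma closed_dist F v : closed F -> ~ F v ->
  exists2 d : R, 0 < d & forall y, F y -> d <= nrm (v - y).
Proof.
move=> /closed_nrmP Fc Fv; apply: contrapT => no; apply: Fv; apply: Fc => e e0.
apply: contrapT => noy; apply: no; exists e => // y Fy.
by rewrite leNgt; apply/negP => h; apply: noy; exists y.
Qed.

(** If [d] bounds the distance from [v] to [F] below, then [a *: v + y] has norm at least [d] times
    that of [a]; this bounds [a], and then [y]. *)
Lemma closed_subspace_add_line F v : closed_subspace F ->
  closed_subspace (add_line F v).
Proof.
move=> [Fs Fc]; split; first exact: subspace_add_line.
have [Fv|Fv] := pselect (F v); first by rewrite add_line_id.
have [d d0 dist] := closed_dist Fc Fv.
have -> : add_line F v = line_map v @` (F `*` [set: R[i]^o]).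
  apply/seteqP; split=> x.
    by move=> [a [y [Fy ->]]]; exists (y, a); rewrite // /line_map addrC.
  by move=> [[y a] [/= Fy _] <-]; exists a, y; rewrite /line_map addrC.
have v0 := nrm_ge0 v.
apply: (closed_image (c := 1 + (1 + nrm v) / d) (bounded_line_map v)).
- split; first by split=> //; exact: Fs.1.
  by move=> a [x b] [x' b'] [Fx _] [Fx' _]; split=> //; exact: Fs.2.
- by apply: complete_setX; [exact: closed_complete|exact: complete_scalars].
- by rewrite addr_ge0// divr_ge0 ?addr_ge0// ltW.
move=> [y a] [/= Fy _]; exists (y, a); split=> //.
set w := line_map v (y, a); set n := nrm (a : R[i]^o).
have an : n <= nrm w / d.
  rewrite ler_pdivlMr//; have [a0|a0] := eqVneq a 0.
    by rewrite /n a0 nrm0 mul0r nrm_ge0.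
  have -> : w = a *: (v - (- a^-1) *: y).
    rewrite scalerBr scalerA mulrN mulfV// scaleN1r opprK addrC.
    by [].
  rewrite nrmZ ler_wpM2l ?nrm_ge0//; apply: dist; exact: subspaceZ.
have yn : nrm y <= nrm w + n * nrm v.
  have -> : y = w - a *: v by rewrite /w /line_map /= addrK.
  by apply: (le_trans (nrmD _ _)); rewrite nrmN nrmZ.
have wn := nrm_ge0 w; have nn : 0 <= n by exact: nrm_ge0.
have wd : 0 <= nrm w / d by rewrite divr_ge0// ltW.
have nv : n * nrm v <= nrm w / d * nrm v by rewrite ler_wpM2r.
have -> : (1 + (1 + nrm v) / d) * nrm w =
    nrm w + nrm w / d + nrm w / d * nrm v by ring.
have wdv : 0 <= nrm w / d * nrm v by rewrite mulr_ge0.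
rewrite nrm_prod_le /=; apply/andP; split; first lra.
by rewrite -/n; lra.
Qed.

Lemma closed_subspace_sumset_span F s : closed_subspace F ->
  closed_subspace (sumset F (lspan s)).
Proof.
elim: s F => [|v s IH] F Fc; first by rewrite sumset_span_nil.
by rewrite sumset_span_cons; apply: IH; exact: closed_subspace_add_line.
Qed.

Lemma closed_subspace0 : closed_subspace [set 0 : X].
Proof.
split; first exact: subspace0.
apply/closed_nrmP => x hx /=; apply: nrm_eq0; apply: le_anti; rewrite nrm_ge0 andbT.
by apply/ler_addgt0Pr => e e0; have [y -> h] := hx e e0; move: h; rewrite subr0 add0r => /ltW.
Qed.

Lemma closed_subspace_span s : closed_subspace (lspan s).
Proof.
have := closed_subspace_sumset_span s closed_subspace0.
congr closed_subspace; apply/seteqP; split=> x.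
  by move=> [y [z [-> sz ->]]]; rewrite add0r.
by move=> sx; exists 0, x; rewrite add0r.
Qed.

(* Enlarging [F] by the kernel does not change its image, and above the kernel
   the preimages bounded in [M] already lie in the enlarged subspace. *)
Lemma bounded_preimages_sub (S : {linear X -> X}) M F c : is_subspace F ->
  F `<=` M -> is_subspace M -> ker_on M S `<=` F ->
  bounded_preimages S M c -> bounded_preimages S F c.
Proof.
move=> Fs FM Ms kF bp x Fx; have [y [My Sy yc]] := bp _ (FM _ Fx).
exists y; split=> //; rewrite -(subrK x y); apply: subspaceD => //; apply: kF.
split; first by apply: subspaceB => //; exact: FM.
by rewrite /= linearB /= Sy subrr.
Qed.

Lemma closed_subspace_image (S : {linear X -> X}) M F c : bounded_op S ->
  closed_subspace F -> F `<=` M -> is_subspace M -> ker_on M S `<=` F ->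
  0 <= c -> bounded_preimages S M c -> closed_subspace (S @` F).
Proof.
move=> Sb [Fs Fc] FM Ms kF c0 bp; split; first exact: subspace_image.
apply: (closed_image Sb Fs _ c0); first exact: closed_complete.
exact: (bounded_preimages_sub Fs FM Ms kF bp).
Qed.

Lemma subspace_ker_on (S : {linear X -> X}) M : is_subspace M ->
  is_subspace (ker_on M S).
Proof.
move=> [M0 Ml]; split; first by split=> //=; rewrite linear0.
move=> a x y [Mx Sx] [My Sy]; split; first exact: Ml.
by rewrite /= linearP; move: Sx Sy => /= -> ->; rewrite scaler0 addr0.
Qed.

(** A finite-dimensional kernel can be added to [F] without losing closedness, so [F] need not
    contain it. *)
Lemma closed_subspace_image_fin (S : {linear X -> X}) M F c s : bounded_op S ->
  closed_subspace F -> F `<=` M -> is_subspace M -> ker_on M S = lspan s ->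
  0 <= c -> bounded_preimages S M c -> closed_subspace (S @` F).
Proof.
move=> Sb Fc FM Ms kE c0 bp.
have -> : S @` F = S @` (sumset F (lspan s)).
  apply/seteqP; split=> x; rewrite -kE.
    move=> [y Fy <-]; exists y => //; exists y, 0; split=> //; last by rewrite addr0.
    by apply: (subspace_ker_on _ _).1.
  move=> [_ [y [z [Fy [_ /= Sz] ->]]] <-]; exists y => //.
  by rewrite linearD /= Sz addr0.
apply: (closed_subspace_image Sb _ _ Ms _ c0 bp).
- exact: closed_subspace_sumset_span.
- rewrite -kE => _ [y [z [Fy [Mz _] ->]]]; apply: subspaceD => //; exact: FM.
- by rewrite -kE => x kx; exists 0, x; split; rewrite ?add0r//; case: Fc => -[].
Qed.

End ClosedSums.

(** * Perturbation of Kato operators *)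

Section Iterates.
Context {R : realType} {X : normedModType R[i]}.
Implicit Types (S : {linear X -> X}) (F M : set X) (x y : X).

Lemma iter_linP S n a x y : iter n S (a *: x + y) = a *: iter n S x + iter n S y.
Proof. by elim: n => //= n ->; rewrite linearP. Qed.

Lemma iter_lin0 S n : iter n S 0 = 0.
Proof. by elim: n => //= n ->; rewrite linear0. Qed.

Lemma iter_linZ S n a x : iter n S (a *: x) = a *: iter n S x.
Proof. by rewrite -[a *: x]addr0 iter_linP iter_lin0 addr0. Qed.

Lemma iter_linD S n x y : iter n S (x + y) = iter n S x + iter n S y.
Proof. by rewrite -[x]scale1r iter_linP !scale1r. Qed.

Lemma iter_linB S n x y : iter n S (x - y) = iter n S x - iter n S y.
Proof. by rewrite iter_linD -scaleN1r iter_linZ scaleN1r. Qed.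

Lemma iter_image S n M : iter n.+1 S @` M = S @` (iter n S @` M).
Proof. by rewrite image_comp. Qed.

Lemma subspace_iter_image S n M : is_subspace M -> is_subspace (iter n S @` M).
Proof.
move=> [M0 Ml]; split; first by exists 0; rewrite ?iter_lin0.
move=> a _ _ [x Mx <-] [y My <-]; exists (a *: x + y); first exact: Ml.
by rewrite iter_linP.
Qed.

Lemma iter_invariant (S : X -> X) n M x : Defs.invariant S M -> M x -> M (iter n S x).
Proof. by move=> SM Mx; elim: n => //= n; exact: SM. Qed.

Lemma iter_image_sub S n M : Defs.invariant S M -> iter n S @` M `<=` M.
Proof. by move=> SM _ [x Mx <-]; exact: iter_invariant. Qed.

Lemma bounded_op_shift S (lam : R[i]) : bounded_op S ->
  bounded_op (S \- lam \*: idfun).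
Proof.
move=> [k k0 Sk]; exists (k + nrm (lam : R[i]^o)); first by rewrite ltr_pwDl ?nrm_ge0.
move=> x /=; apply: (le_trans (nrmD _ _)); rewrite nrmN nrmZ mulrDl lerD//.
Qed.

Lemma invariant_shift S (lam : R[i]) M : is_subspace M -> Defs.invariant S M ->
  Defs.invariant (S \- lam \*: idfun) M.
Proof.
move=> Ms SM x Mx /=; apply: subspaceB => //; first exact: SM.
exact: subspaceZ.
Qed.

End Iterates.

(** Arithmetic of the induction in [hyperrange_approx]: [d] is the current distance, [p] the part
    controlled by the shifted operator, [b] the part that halves. *)
Lemma half_error (R : realFieldType) (p q d b : R) :
  q <= 1 / 2 * d -> d <= 2 * p + b -> p + q <= 2 * p + b / 2.
Proof. lra. Qed.

(** * The shift on the Kato summand *)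

Section KatoPerturbation.
Context {R : realType} {X : completeNormedModType R[i]}.
Context (T : {linear X -> X}) (M : set X) (c : R) (lam : R[i]).
Hypotheses (Tb : bounded_op T) (Mc : closed_subspace M) (TM : Defs.invariant T M).
Hypotheses (TK : Kato_on M T) (c0 : 0 < c) (bp : bounded_preimages T M c).
Hypotheses (lam0 : lam != 0) (lamc : nrm (lam : R[i]^o) * c <= 1 / 2).

Definition hyperrange : set X := [set x | forall n, (iter n T @` M) x].
Local Notation Y := hyperrange.
Local Notation S := (T \- lam \*: idfun : {linear X -> X}).

(** By the Kato condition each range contains the kernel, so [T] maps it to a closed subspace
    again. *)
Lemma closed_iter_image n : closed_subspace (iter n T @` M).
Proof.
elim: n => [|n IH]; first by rewrite image_id.
rewrite iter_image; apply: (closed_subspace_image Tb IH _ Mc.1 _ (ltW c0) bp).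
- exact: iter_image_sub.
- exact: TK.2.
Qed.

Lemma closed_hyperrange : closed_subspace Y.
Proof.
split.
  split; first by move=> n; exact: (closed_iter_image n).1.1.
  by move=> a x y Yx Yy n; apply: (closed_iter_image n).1.2.
apply/closed_nrmP => x hx n; have [_ /closed_nrmP] := closed_iter_image n.
by apply=> e e0; have [y Yy xy] := hx e e0; exists y.
Qed.

Lemma hyperrange_sub : Y `<=` M.
Proof. by move=> x /(_ 0%N); rewrite image_id. Qed.

Lemma hyperrange_ker : ker_on M T `<=` Y.
Proof. by move=> x kx n; exact: TK.2. Qed.

Lemma hyperrange_invariant : Defs.invariant T Y.
Proof.
move=> x Yx n; have [z Mz <-] := Yx n.
by exists (T z); [exact: TM|rewrite -iterSr].
Qed.

(** If [T x = T^(n+1) z], then [x - T^n z] is in the kernel, which lies in the range of [T^n]. *)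
Lemma hyperrange_preimage x : M x -> Y (T x) -> Y x.
Proof.
move=> Mx YTx n; have := YTx n.+1; rewrite iter_image => -[y [z Mz <-]] Ty.
rewrite -(subrK (iter n T z) x); apply: (subspaceD (subspace_iter_image T n Mc.1)); last by exists z.
apply: TK.2; split; last by rewrite /= linearB /= Ty subrr.
by apply: (subspaceB Mc.1) => //; exact: iter_invariant.
Qed.

(** All preimages in [M] of a point of [Y] lie in [Y], in particular the bounded one. *)
Lemma hyperrange_lift x : Y x -> exists y, [/\ Y y, T y = x & nrm y <= c * nrm x].
Proof.
move=> Yx; have [z Mz zE] := Yx 1%N.
have [y [My Ty yc]] := bp Mz; exists y; rewrite -zE; split=> //.
by apply: hyperrange_preimage => //; rewrite Ty; move: Yx; rewrite -zE.
Qed.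

(** Lifting [w] by [T] instead of [S] leaves the residual [lam *: x], which stays in [Y] and has at
    most half the norm of [w]. *)
Lemma hyperrange_shift_onto w : Y w ->
  exists x, [/\ Y x, S x = w & nrm x <= 4 * c * nrm w].
Proof.
have [Ys Yc] := closed_hyperrange.
apply: (approx_solve (bounded_op_shift lam Tb) Ys (closed_complete Yc) (ltW c0)).
move=> {}w Yw; have [x [Yx Tx xc]] := hyperrange_lift Yw.
have E : w - S x = lam *: x by rewrite /= Tx subKr.
exists x; rewrite E; split=> //; last exact: (subspaceZ lam Ys).
rewrite nrmZ; apply: (@le_trans _ _ (nrm (lam : R[i]^o) * (c * nrm w))).
  by rewrite ler_wpM2l ?nrm_ge0.
rewrite mulrA; have := nrm_ge0 w => w0.
by apply: (le_trans (ler_wpM2r w0 lamc)); lra.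
Qed.

(* If [T u = lam y] with [u] in [Y], then [T (x - u) = S x + lam (x - y)]; lifting
   this back by [T] halves the part of the distance not controlled by [S x]. *)
Lemma hyperrange_approx x n : M x ->
  exists y, Y y /\ nrm (x - y) <= 2 * c * nrm (S x) + nrm x / 2 ^+ n.
Proof.
move=> Mx; have Ys := closed_hyperrange.1; have w0 := nrm_ge0 (S x).
elim: n => [|n [y [Yy xy]]].
  exists 0; split; first exact: Ys.1.
  by rewrite subr0 divr1 lerDr !mulr_ge0// ltW.
have Yly : Y (lam *: y) by exact: (subspaceZ lam Ys).
have [u [Yu Tu _]] := hyperrange_lift Yly.
have [v [Mv Tv vc]] : exists v, [/\ M v, T v = T (x - u) & nrm v <= c * nrm (T (x - u))].
  by apply: bp; apply: (subspaceB Mc.1) => //; exact: hyperrange_sub.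
exists (x - v); split.
  rewrite -(subrK u (x - v)); apply: (subspaceD Ys) => //; apply: hyperrange_ker.
  rewrite addrAC; split.
    by do 2![apply: (subspaceB Mc.1) => //]; exact: hyperrange_sub.
  by rewrite /= linearB /= Tv subrr.
rewrite subKr; apply: (le_trans vc).
have -> : T (x - u) = S x + lam *: (x - y).
  by rewrite linearB /= Tu scalerBr addrA subrK.
have h : nrm (S x + lam *: (x - y)) <= nrm (S x) + nrm (lam : R[i]^o) * nrm (x - y).
  by rewrite -nrmZ nrmD.
have := ler_wpM2l (ltW c0) h => {}h; apply: (le_trans h).
have := ler_wpM2r (nrm_ge0 (x - y)) lamc => h2.
have -> : c * (nrm (S x) + nrm (lam : R[i]^o) * nrm (x - y)) =
  c * nrm (S x) + nrm (lam : R[i]^o) * c * nrm (x - y) by ring.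
rewrite exprSr invfM [nrm x * _]mulrA -[2 * c * _]mulrA.
by apply: half_error h2 _; rewrite mulrA.
Qed.

Lemma Kato_shift : Kato_on M S.
Proof.
have Ms := Mc.1; have Ys := closed_hyperrange.1.
have SM := invariant_shift lam Ms TM.
split; last first.
  move=> n x [Mx /= /eqP]; rewrite subr_eq0 => /eqP Tx.
  (* An eigenvector for [lam] is the image under [T^m] of its own multiple by [lam ^- m]. *)
  have Yx : Y x.
    move=> m; exists (lam ^- m *: x); first exact: subspaceZ.
    rewrite iter_linZ; have -> : iter m T x = lam ^+ m *: x.
      by elim: m => [|m IH]; rewrite ?scale1r//= IH linearZ /= Tx scalerA -exprSr.
    by rewrite scalerA mulVf ?scale1r// expf_neq0.
  (* As [S] maps [Y] onto itself, [x] can be lifted [n] times within [Y]. *)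
  suff [y Yy <-] : (iter n S @` Y) x by exists y => //; exact: hyperrange_sub.
  elim: n => [|n [y Yy yE]]; first by exists x.
  have [z [Yz Sz _]] := hyperrange_shift_onto Yy.
  by exists z => //; rewrite iterSr -yE -Sz.
have Sb := bounded_op_shift lam Tb; have [k k0 Sk] := Sb.
(* The terms bound [x - y] and [z] in the preimage [x - y + z] chosen below, where [z] is a bounded
   replacement of [y] in [Y] with [S z = S y]. *)
have C0 : 0 <= 3 * c + 4 * c * (1 + k * (3 * c)).
  by rewrite addr_ge0 ?mulr_ge0 ?addr_ge0 ?mulr_ge0 ?mulr_ge0// ltW.
apply: (closed_image Sb Ms (closed_complete Mc.2) C0) => x Mx.
have [w0|/eqP/nrm_gt0 w0] := eqVneq (S x) 0.
  by exists 0; rewrite w0 linear0 !nrm0 mulr0; split=> //; exact: Ms.1.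
(* This makes the remainder [nrm x / 2 ^+ n] smaller than [c * nrm (S x)], which is why [S x = 0]
   was set aside. *)
have [n xn] := halving_small (halving_geom (nrm_ge0 x)) (mulr_gt0 c0 w0).
have [y [Yy xy]] := hyperrange_approx n Mx.
have YSy : Y (S y) by exact: invariant_shift Ys hyperrange_invariant _ Yy.
have [z [Yz Sz zc]] := hyperrange_shift_onto YSy.
have My := hyperrange_sub Yy; have Mz := hyperrange_sub Yz.
exists (x - y + z); split.
- by apply: subspaceD => //; exact: subspaceB.
- by rewrite linearD Sz linearB subrK.
have xy3 : nrm (x - y) <= 3 * c * nrm (S x) by lra.
have Syn : nrm (S y) <= (1 + k * (3 * c)) * nrm (S x).
  have -> : S y = S x - S (x - y) by rewrite -[RHS]linearB subKr.
  apply: (le_trans (nrmD _ _)); rewrite nrmN mulrDl mul1r lerD// -mulrA.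
  by apply: (le_trans (Sk _)); rewrite ler_pM2l.
apply: (le_trans (nrmD _ _)); rewrite mulrDl lerD//.
apply: (le_trans zc); rewrite -!mulrA ler_wpM2l// ler_pM2l//.
Qed.

End KatoPerturbation.

(** * Kato decomposition of Fredholm operators *)

Section JordanChain.
Context {R : realType} {X : normedModType R[i]}.
Context (S : {linear X -> X}).
Implicit Types (H N : set X) (x y u z : X).
Local Notation lspan := (@Defs.span R[i] X).

Lemma iter_killed m n y : (m <= n)%N -> iter m S y = 0 -> iter n S y = 0.
Proof. by move=> mn Sy; rewrite -(subnK mn) iterD Sy iter_lin0. Qed.

Lemma span_chain_killed m y z : iter m S y = 0 ->
  lspan (traject S y m) z -> iter m S z = 0.
Proof.
elim: m y z => [|m IH] y z Sy; first by rewrite span_nil => ->.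
rewrite [traject _ _ _]/= span_cons => -[a [w [sw ->]]].
rewrite iter_linP Sy scaler0 add0r iterS (IH (S y)) ?linear0// -iterSr //.
Qed.

Lemma span_chain_invariant m y : iter m S y = 0 ->
  Defs.invariant S (lspan (traject S y m)).
Proof.
elim: m y => [|m IH] y Sy z; first by rewrite span_nil => ->; rewrite linear0.
rewrite [traject _ _ _]/= span_cons => -[a [w [sw ->]]].
rewrite linearP; apply: sub_add_line; apply: (subspaceD (subspace_span _)).
  apply: (subspaceZ _ (subspace_span _)); case: m {IH sw} Sy => [|m] Sy.
    by rewrite span_nil.
  by apply: mem_span; rewrite /= mem_head.
by apply: IH => //; rewrite -iterSr.
Qed.

(* Reducing [u] modulo the chain: the coefficients are determined in the order
   in which the pairings [S^i (S^j y)] with [i + j = m - 1] become triangular. *)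
Lemma span_chain_reduce H N x m y u : is_subspace H -> is_subspace N ->
  Defs.invariant S N -> (forall u, N u -> exists a, H (u - a *: x)) ->
  S x = 0 -> N u -> N y -> (forall j, m = j.+1 -> iter j S y = x) ->
  (forall i, (m <= i)%N -> H (iter i S u)) ->
  exists z, lspan (traject S y m) z /\ forall i, H (iter i S (u - z)).
Proof.
move=> Hs Ns SN NH Sx; elim: m y u => [|m IH] y u Nu Ny yx Hu.
  by exists 0; rewrite span_nil; split=> // i; rewrite subr0; exact: Hu.
have Sy : iter m S y = x by exact: yx.
(* As [S^m y = x], subtracting [a *: y] puts the [m]-th power into [H] as well, and the shorter
   chain from [S y] takes care of the lower powers. *)
have [a Ha] := NH _ (iter_invariant m SN Nu).
have [||j mE|i mi|z [sz Hz]] := IH (S y) (u - a *: y).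
- by apply: (subspaceB Ns) => //; exact: (subspaceZ a Ns).
- exact: SN.
- by rewrite -iterSr -mE.
- rewrite iter_linB iter_linZ; move: mi; rewrite leq_eqVlt => /orP[/eqP <-|mi].
    by rewrite Sy.
  have Sy0 : iter m.+1 S y = 0 by rewrite iterS Sy.
  rewrite (iter_killed mi Sy0).
  by rewrite scaler0 subr0; exact: Hu.
exists (a *: y + z); split; last by rewrite opprD addrA.
by rewrite [traject _ _ _]/= span_cons; exists a, z.
Qed.

(** The highest power kills all of the chain but its head, which it sends to [x]; as [x] is outside
    [H], the head has coefficient [0], and the argument repeats on the shorter chain. *)
Lemma span_chain_disjoint H x m y z : is_subspace H -> ~ H x -> S x = 0 ->
  (forall j, m = j.+1 -> iter j S y = x) -> lspan (traject S y m) z ->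
  (forall i, H (iter i S z)) -> z = 0.
Proof.
move=> Hs Hx Sx; elim: m y z => [|m IH] y z yx; first by rewrite span_nil.
rewrite [traject _ _ _]/= span_cons => -[a [w [sw ->]]] Hz.
have Sy : iter m S y = x by exact: yx.
have Sw : iter m S w = 0.
  by apply: span_chain_killed sw; rewrite -iterSr iterS Sy.
have a0 : a = 0.
  apply/eqP/negP => /negP a0; apply: Hx.
  have := subspaceZ a^-1 Hs (Hz m).
  by rewrite iter_linP Sy Sw addr0 scalerA mulVf// scale1r.
move: Hz; rewrite a0 scale0r add0r; apply: (IH (S y)) => // j mE.
by rewrite -iterSr -mE.
Qed.

End JordanChain.

(** * Splitting off Jordan chains *)

Section FredholmDecomposition.
Context {R : realType} {X : completeNormedModType R[i]}.
Implicit Types (F H M N W : set X) (u v x y z : X) (s t : seq X).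
Local Notation lspan := (@Defs.span R[i] X).

(** Finite codimension takes the place of Hahn-Banach: the vectors of [s] are added to [W] one by
    one, except those that would bring in [x]. *)
Lemma separating_hyperplane N W x s : closed_subspace W -> ~ W x ->
  N `<=` sumset (add_line W x) (lspan s) ->
  exists H, [/\ closed_subspace H, W `<=` H, ~ H x &
    forall u, N u -> exists a, H (u - a *: x)].
Proof.
elim: s W => [|v s IH] W Wc Wx NW.
  exists W; split=> // u /NW; rewrite sumset_span_nil => -[a [w [Ww ->]]].
  by exists a; rewrite addrC addKr.
have Ws := Wc.1; rewrite sumset_span_cons in NW.
have [[a [w [Ww xE]]]|nx] := pselect (add_line W v x).
  apply: IH => //; move: NW; rewrite (add_line_id (subspace_add_line x Ws)) //.
  have a0 : a != 0.
    by apply/eqP => a0; apply: Wx; rewrite xE a0 scale0r add0r.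
  exists a^-1, (- (a^-1 *: w)); split.
    by apply: (subspaceN Ws); exact: (subspaceZ _ Ws).
  by rewrite xE scalerDr scalerA mulVf// scale1r addrK.
have [|H [Hc WH Hx HN]] := IH _ (closed_subspace_add_line v Wc) nx.
  move=> u /NW [_ [z [[a [_ [[b [w [Ww ->]]] ->]]] sz ->]]].
  exists (b *: x + (a *: v + w)), z; split=> //; last by rewrite addrCA.
  by exists b, (a *: v + w); split=> //; exists a, w.
by exists H; split=> // u Wu; apply: WH; exact: sub_add_line.
Qed.

Context (S : {linear X -> X}) (Sb : bounded_op S).

Lemma closed_subspace_preimage F : closed_subspace F ->
  closed_subspace [set u | F (S u)].
Proof.
move=> [[F0 Fl] /closed_nrmP Fc]; have [k k0 Sk] := Sb.
split.
  split; first by rewrite /= linear0.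
  by move=> a x y Fx Fy; rewrite /= linearP; exact: Fl.
apply/closed_nrmP => u hu; apply: Fc => e e0.
have [y Fy uy] := hu _ (divr_gt0 e0 k0).
exists (S y) => //; rewrite -linearB; apply: (le_lt_trans (Sk _)).
by rewrite mulrC -ltr_pdivlMr.
Qed.

(** This is the largest [S]-invariant subspace of [F], an intersection of closed preimages. *)
Lemma closed_subspace_orbit F : closed_subspace F ->
  closed_subspace [set u | forall i, F (iter i S u)].
Proof.
move=> Fc.
have Pc i : closed_subspace [set u | F (iter i S u)].
  elim: i => [|i IH]; first exact: Fc.
  have := closed_subspace_preimage IH; congr closed_subspace.
  by apply/seteqP; split=> u /=; rewrite -iterSr.
split.
  split; first by move=> i; exact: (Pc i).1.1.
  by move=> a x y Fx Fy i; exact: (Pc i).1.2.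
apply/closed_nrmP => u hu i; have [_ /closed_nrmP] := Pc i; apply=> e e0.
by have [y Fy uy] := hu e e0; exists y.
Qed.

Lemma closed_subspaceI F M : closed_subspace F -> closed_subspace M ->
  closed_subspace (F `&` M).
Proof.
move=> [Fs Fc] [Ms Mc]; split; first exact: subspaceI.
exact: closedI.
Qed.

Lemma iter_image_fin_codim N t n : N `<=` sumset (S @` N) (lspan t) ->
  exists t', N `<=` sumset (iter n S @` N) (lspan t').
Proof.
move=> Nt; elim: n => [|n [t' IH]].
  by exists [::]; rewrite sumset_span_nil image_id.
exists (map S t' ++ t) => u /Nt [_ [z [[v /IH [w [z' [nw sz' ->]]] <-] sz ->]]].
exists (S w), (S z' + z); split; last by rewrite linearD addrA.
  by rewrite iter_image; exists w.
rewrite span_cat -image_span; exists z, (S z'); split=> //; last by rewrite addrC.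
by exists z'.
Qed.

(* A kernel vector [x] with [x = S^k y] but [x] outside the range of [S^(k+1)]
   splits off the Jordan chain [y, S y, ..., S^k y]; the complement has a strictly
   smaller kernel. *)
Lemma Fredholm_Kato_decomposition N s t : closed_subspace N ->
  Defs.invariant S N -> ker_on N S = lspan s -> closed (S @` N) ->
  N `<=` sumset (S @` N) (lspan t) ->
  exists M r, [/\ closed_subspace M, M `<=` N, Defs.invariant S M & Kato_on M S] /\
    [/\ lspan r `<=` N, Defs.invariant S (lspan r), nilpotent_on (lspan r) S,
      N `<=` sumset M (lspan r) & forall u, M u -> lspan r u -> u = 0].
Proof.
(* Induction on the length of a list spanning the kernel. *)
have [d] := ubnP (size s); elim: d N s t => // d IH N s t sd Nc SN kE SNc Nt.
have Ns := Nc.1.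
have [SK|nK] := pselect (Kato_on N S).
  exists N, [::]; split; [by split|split]; rewrite ?sumset_span_nil ?span_nil//.
  - by move=> _ ->; exact: Ns.1.
  - by move=> _ ->; rewrite /= linear0.
  - by exists 0%N.
(* The range is closed, so some kernel vector misses some range; it lies in [N], the range of the
   zeroth power, hence there is a last [k] before it drops out. *)
have [x [kx [k [y Ny yx] xk]]] : exists x, ker_on N S x /\
    exists2 k, (iter k S @` N) x & ~ (iter k.+1 S @` N) x.
  apply: contrapT => no; apply: nK; split=> // n x kx; apply: contrapT => xn.
  apply: no; exists x; split=> //; apply: contrapT => nok; apply: xn.
  elim: n => [|n IHn]; first by rewrite image_id; case: kx.
  by apply: contrapT => xn; apply: nok; exists n.
have Sx : S x = 0 by case: kx.
have [||c c0 bp] := open_mapping Sb Ns; [exact: closed_complete Nc.2|exact: closed_complete|].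
have cimage F : closed_subspace F -> F `<=` N -> closed_subspace (S @` F).
  by move=> Fc FN; exact: (closed_subspace_image_fin Sb Fc FN Ns kE (ltW c0) bp).
have Wc n : closed_subspace (iter n S @` N).
  elim: n => [|n IHn]; first by rewrite image_id.
  by rewrite iter_image; apply: cimage => //; exact: iter_image_sub.
have [t' Nt'] := iter_image_fin_codim k.+1 Nt.
have [|H [Hc WH Hx HN]] := separating_hyperplane (N := N) (s := t') (Wc k.+1) xk.
  move=> u /Nt' [w [z [Ww sz ->]]]; exists w, z; split=> //; exact: sub_add_line.
have Hs := Hc.1.
(* The invariant part of the hyperplane will be the complement of the chain in [N]. *)
pose M' := N `&` [set u | forall i, H (iter i S u)].
have M'c : closed_subspace M' by apply: closed_subspaceI => //; exact: closed_subspace_orbit.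
have M'N : M' `<=` N by move=> u [].
have SM' : Defs.invariant S M'.
  by move=> u [Nu Hu]; split=> [|i]; [exact: SN|rewrite -iterSr; exact: Hu].
pose r := traject S y k.+1.
have yk : forall j, k.+1 = j.+1 -> iter j S y = x by move=> j [<-].
have Sy : iter k.+1 S y = 0 by rewrite iterS yx.
have dec u : N u -> exists z, lspan r z /\ M' (u - z).
  (* Powers beyond [k] send [u] into the range of [S^(k+1)], hence into [H]. *)
  move=> Nu; have [i ki|z [rz Hz]] := span_chain_reduce Hs Ns SN HN Sx Nu Ny yk.
    apply: WH; rewrite -(subnKC ki) iterD.
    by exists (iter (i - k.+1) S u) => //; exact: iter_invariant.
  exists z; split=> //; split=> //; apply: (subspaceB Ns) => //.
  apply: (span_sub Ns _ rz) => v /trajectP[j _ ->]; exact: iter_invariant.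
have rN : lspan r `<=` N.
  by apply: (span_sub Ns) => v /trajectP[j _ ->]; exact: iter_invariant.
have [||s' [s'E _ s's]] := @subspace_span_size _ _ s (ker_on M' S).
- exact: subspace_ker_on M'c.1.
- by rewrite -kE => u [/M'N].
(* The vector [x] is in the kernel on [N] but not in [H], so the kernel on [M'] is strictly
   smaller. *)
have {}s's : (size s' < size s)%N.
  by apply: s's; rewrite -kE => E; have := kx; rewrite -E => -[[_ /(_ 0%N)]].
(* Passing to [M'] may remove the images of the chain from the range, so they join [t] as
   complementary vectors. *)
have [||M [r' [[Mc MM' SM MK] [r'M' Sr' [n nr'] M'r' Mr']]]] :=
  IH M' s' (map S r ++ t) (leq_trans s's sd) M'c SM' s'E.
- exact: (cimage _ M'c M'N).2.
- move=> u /M'N/Nt [_ [z [[v Nv <-] tz ->]]].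
  have [w [rw M'w]] := dec v Nv.
  exists (S (v - w)), (S w + z); split; first by exists (v - w).
    rewrite span_cat -image_span; exists z, (S w); split=> //; last by rewrite addrC.
    by exists w.
  by rewrite addrA -linearD subrK.
exists M, (r' ++ r); split; first by split=> // u /MM'/M'N.
rewrite span_cat; split.
- move=> _ [v [w [rv rw ->]]]; apply: (subspaceD Ns); first exact: rN.
  by apply: M'N; exact: r'M'.
- move=> _ [v [w [rv rw ->]]]; exists (S v), (S w).
  by split; [exact: span_chain_invariant|exact: Sr'|rewrite linearD].
- exists (n + k.+1)%N => _ [v [w [rv rw ->]]]; rewrite iter_linD.
  rewrite (iter_killed (leq_addl _ _) (span_chain_killed Sy rv)).
  by rewrite (iter_killed (leq_addr _ _) (nr' _ rw)) addr0.
- move=> u Nu; have [v [rv M'uv]] := dec u Nu.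
  have [m [w [Mm rw uvE]]] := M'r' _ M'uv.
  exists m, (v + w); split=> //; first by exists v, w.
  by rewrite addrCA -uvE addrC subrK.
- move=> u Mu [v [w [rv rw uE]]]; move: Mu; rewrite uE => Mvw.
  have v0 : v = 0.
    apply: (span_chain_disjoint Hs Hx Sx yk rv).
    have : M' (v + w - w) by apply: (subspaceB M'c.1); [exact: MM'|exact: r'M'].
    by rewrite addrK => -[].
  by move: Mvw; rewrite v0 add0r => Mw; exact: Mr'.
Qed.

End FredholmDecomposition.

(** * Gluing the two summands *)

Theorem theorem3p5 (R : realType) (X : completeNormedModType R[i])
  (T : {linear X -> X}) (hT : continuous T)
  (hX : ~ finite_dim [set: X])
  (M N : set X) (hMN : GKRD T M N) :
  exists eps : R, (0 < eps)%R /\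
    forall lam : R[i], (0 < `|lam|)%R -> (`|lam| < eps%:C)%R ->
      essentially_Kato (fun x : X => T x - lam *: x).
Proof.
have [Mc [Nc [TM [TN [MN [TK TR]]]]]] := hMN.
have Tb := continuous_bounded_op hT.
have [||c c0 bp] := open_mapping Tb Mc.1.
- exact: closed_complete Mc.2.
- exact: closed_complete TK.1.
(* This radius is what makes [|lam| * c <= 1 / 2], the smallness required on [M]. *)
have eps0 : 0 < (2 * c)^-1 by rewrite invr_gt0 mulr_gt0.
exists (2 * c)^-1; split=> // lam; rewrite normr_gt0 => lam0 lame.
have lamc : nrm (lam : R[i]^o) * c <= 1 / 2.
  have : nrm (lam : R[i]^o) < (2 * c)^-1 by rewrite -ltcR -nrmE.
  move=> /ltW/(ler_wpM2r (ltW c0)) h; apply: (le_trans h).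
  by rewrite invfM -mulrA mulVf ?gt_eqF// mulr1 div1r.
pose S : {linear X -> X} := T \- lam \*: idfun.
have Sb : bounded_op S by exact: bounded_op_shift.
have SM : Defs.invariant S M by exact: invariant_shift Mc.1 TM.
have SN : Defs.invariant S N by exact: invariant_shift Nc.1 TN.
have SK : Kato_on M S by exact: (Kato_shift Tb Mc TM TK c0 bp lam0 lamc).
(* Being Riesz on [N] gives the Fredholm property of the shift there, as [lam] is nonzero. *)
have [[s kE] [SNc [t [_ Nt]]]] := TR lam lam0.
have Nt' : N `<=` sumset (S @` N) (@Defs.span R[i] X t).
  by move=> u /Nt [y [z [Sy [tz ->]]]]; exists y, z.
have [M' [r [[M'c M'N SM' M'K] [rN Sr nr Nr M'r]]]] :=
  Fredholm_Kato_decomposition Sb Nc SN kE SNc Nt'.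
have [Ms Ns] := (Mc.1, Nc.1); have [dec dis] := MN.
(* The Kato part [M'] of [N] joins [M]; only the nilpotent chains remain in the other summand. *)
exists (sumset M M'), (@Defs.span R[i] X r).
have sumc F G : closed_subspace F -> closed_subspace G -> F `<=` M -> G `<=` N ->
    closed_subspace (sumset F G).
  exact: closed_sub_direct_sum Mc Nc MN.
split; first by apply: sumc.
split; first exact: closed_subspace_span.
split.
  move=> _ [m [m' [Mm Mm' ->]]]; exists (S m), (S m').
  by split; [exact: SM|exact: SM'|exact: (linearD S)].
split; first exact: Sr.
split.
  split=> [u|u [m [m' [Mm Mm' ->]]] ru].
    have [m [n [Mm [Nn ->]]]] := dec u; have [m' [z [Mm' rz ->]]] := Nr _ Nn.
    by exists (m + m'), z; split; [exists m, m'|split=> //; rewrite addrA].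
  (* Both [m + m'] and [m'] lie in [N], so [m] is in both [M] and [N]. *)
  have m0 : m = 0.
    apply: dis => //; rewrite -(addrK m' m); apply: (subspaceB Ns); first exact: rN.
    exact: M'N.
  by move: ru; rewrite m0 add0r => rm'; exact: M'r.
split; first by exists r.
split; last exact: nr.
have SMM : S @` M `<=` M by move=> _ [m Mm <-]; exact: SM.
have SM'N : S @` M' `<=` N by move=> _ [m Mm <-]; exact/M'N/SM'.
split.
  have -> : (fun x : X => T x - lam *: x) @` sumset M M' =
      sumset (S @` M) (S @` M').
    apply/seteqP; split=> u.
      move=> [_ [m [m' [Mm Mm' ->]]] <-]; exists (S m), (S m').
      by split; [exists m|exists m'|exact: (linearD S)].
    move=> [_ [_ [[m Mm <-] [m' Mm' <-] ->]]]; exists (m + m').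
      by exists m, m'.
    exact: (linearD S).
  apply: (sumc _ _ _ _ SMM SM'N).2.
    by split; [exact: subspace_image|exact: SK.1].
  by split; [exact: subspace_image M'c.1|exact: M'K.1].
move=> n _ [[m [m' [Mm Mm' ->]]] SE].
have {}SE : S m + S m' = 0 by rewrite -linearD.
(* [S m] is in [M] and equals [- S m'], which is in [N]; the kernel thus splits along the direct
   sum. *)
have Sm : S m = 0.
  apply: dis; first exact: SM.
  rewrite -(addrK (S m') (S m)) SE add0r.
  by apply: (subspaceN Ns); exact/M'N/SM'.
have Sm' : S m' = 0 by rewrite Sm add0r in SE.
have [|a Ma aE] := SK.2 n m; first by split.
have [|b Mb bE] := M'K.2 n m'; first by split.
exists (a + b); first by exists a, b.
by rewrite -aE -bE; exact: (iter_linD S).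
Qed.
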